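(* For positive integers $p,q$, \[\mathcal{B}(p,q)=\frac{(-1)^{q}}{2(q-1)!}\left[\int_0^1\frac{\log^{q-1}(x)\,\mathrm{Li}_p(-x)}{x(1+x^2)}\,\mathrm{d}x-\int_0^1\frac{\log^{q-1}(x)\,\mathrm{Li}_p(x)}{x(1+x^2)}\,\mathrm{d}x\right].\]
   Context: $\mathcal{B}_n(p)=\sum_{k=1}^n\frac{(-1)^k}{(2k-1)^p}$ and $\mathcal{B}(p,q)=\sum_{n=1}^{\infty}\frac{(-1)^n\mathcal{B}_n(p)}{(2n-1)^q}$. $\mathrm{Li}_p(x)=\sum_{m\ge1}x^m/m^p$ is the polylogarithm. *)

(* Defs.v *)
From mathcomp Require Import all_boot all_order all_algebra.
From mathcomp Require Import all_classical all_reals all_analysis.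

Set Implicit Arguments.
Unset Strict Implicit.
Unset Printing Implicit Defensive.

Import Order.TTheory GRing.Theory Num.Theory numFieldNormedType.Exports.

Local Open Scope classical_set_scope.
Local Open Scope ring_scope.

Definition calB_fin {R : realType} (p n : nat) : R :=
  \sum_(1 <= k < n.+1) (-1) ^+ k / (2 * k%:R - 1) ^+ p.

Definition calB_psum {R : realType} (p q N : nat) : R :=
  \sum_(1 <= n < N.+1) (-1) ^+ n * calB_fin p n / (2 * n%:R - 1) ^+ q.

(* The series is only conditionally convergent when q = 1, so the order of
   summation matters; [limn] is meaningful only once convergence is known. *)
Definition calB {R : realType} (p q : nat) : R := limn (@calB_psum R p q).

(* Used only for -1 < x < 1, where the series converges absolutely. *)
Definition Li {R : realType} (p : nat) (x : R) : R :=
  limn (fun N : nat => \sum_(1 <= m < N.+1) x ^+ m / m%:R ^+ p).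

(* Main.v *)
Require Import Defs.
From mathcomp Require Import all_boot all_order all_algebra.
From mathcomp Require Import all_classical all_reals all_analysis.
From mathcomp Require Import measurable_realfun ring lra.

(* Put c_n = (-1)^n B_n(p); then c_(n+1) + c_n = 1/(2n+1)^p and |c_n| <= 1, so
   (1 + x^2) * sum_(n < N) c_(n+1) x^(2n) is the N-th partial sum of the odd
   part of Li_p(x)/x up to the remainder c_N x^(2N). The moments
   int_0^1 x^n (-log x)^r / r! dx = 1/(n+1)^(r+1) turn the N-th partial sum of
   B(p, r+1) into the integral of sum_(n < N) c_(n+1) x^(2n) (-log x)^r / r!,
   and dominated convergence with bound 2 (Li_p(x)/x) (-log x)^r / r! lets N
   go to infinity, even when the series is only conditionally convergent. *)

Import Order.TTheory GRing.Theory Num.Theory numFieldNormedType.Exports.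

Local Open Scope classical_set_scope.
Local Open Scope ring_scope.

(** * Powers of the logarithm as weights on ]0, 1[ and their moments *)

Definition logw {R : realType} (r : nat) (x : R) : R := (- ln x) ^+ r / r`!%:R.

Lemma logw_ge0 {R : realType} r (x : R) : x <= 1 -> 0 <= logw r x.
Proof.
move=> x1; rewrite /logw divr_ge0 ?ler0n// exprn_ge0// oppr_ge0.
exact: ln_le0.
Qed.

Lemma logw1 {R : realType} r : logw r.+1 (1 : R) = 0.
Proof. by rewrite /logw ln1 oppr0 expr0n/= mul0r. Qed.

(** Repeated integration by parts of [x ^+ n * logw r x]: each step integrates the power and lowers
    the index of the weight by one. *)
Fixpoint logw_primitive {R : realType} (n r : nat) (x : R) : R :=
  if r is r'.+1 then
    (x ^+ n.+1 * logw r'.+1 x + logw_primitive n r' x) / n.+1%:R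
  else x ^+ n.+1 / n.+1%:R.

(** The factor [1 / r!] in [logw] absorbs the constant [r.+1] of the power rule, so differentiation
    only shifts the index. *)
Lemma is_derive_logw {R : realType} r (x : R) : 0 < x ->
  is_derive x 1 (logw r.+1) (- (logw r x / x)).
Proof.
move=> x0.
have -> : logw r.+1 = (r.+1`!%:R)^-1 *: (- (@ln R)) ^+ r.+1 :> (R -> R).
  by apply/funext => y; rewrite /logw mulrC !fctE.
have dl := is_derive1_ln x0.
apply: is_derive_eq.
rewrite /logw factS natrM /= !fctE.
have r0 : r`!%:R != 0 :> R by rewrite pnatr_eq0 -lt0n fact_gt0.
have r1 : r.+1%:R != 0 :> R by rewrite pnatr_eq0.
rewrite /GRing.scale/=.
by field; rewrite ?r0 ?r1 ?gt_eqF.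
Qed.

Lemma logw_continuous {R : realType} r (x : R) : 0 < x ->
  {for x, continuous (logw r)}.
Proof.
move=> x0; apply: cvgM; last exact: cvg_cst.
apply: (@continuous_comp _ _ _ (fun y => - ln y) (fun y : R => y ^+ r)).
  by apply: continuousN; exact: continuous_ln.
exact: exprn_continuous.
Qed.

Lemma expr_fact_le_expR {R : realType} r (y : R) : 0 <= y ->
  y ^+ r / r`!%:R <= expR y.
Proof.
move=> y0; case: r => [|r].
  by rewrite expr0 fact0 divr1 -expR0 ler_expR.
by apply: le_trans (expR_ge1Dxn r y0); rewrite lerDr.
Qed.

(* [expr_fact_le_expR] at [y = - ln x / 2], where [x * expR y] is [sqrt x]. *)
Lemma mul_logw_le {R : realType} r (x : R) : 0 < x -> x <= 1 ->
  x * logw r x <= 2 ^+ r * Num.sqrt x.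
Proof.
move=> x0 x1; set y := - ln x / 2.
have y0 : 0 <= y by rewrite /y divr_ge0// oppr_ge0 ln_le0.
have lnxy : ln x = 2 * - y by rewrite /y; field.
have -> : logw r x = 2 ^+ r * (y ^+ r / r`!%:R).
  by rewrite /logw lnxy mulrN opprK exprMn mulrA.
have xe : x = expR (- y) ^+ 2 by rewrite -expRM_natl -lnxy lnK.
rewrite {2}xe sqrtr_sqr ger0_norm ?expR_ge0// mulrCA ler_pM2l ?exprn_gt0//.
apply: (@le_trans _ _ (x * expR y)).
  by rewrite ler_pM2l// expr_fact_le_expR.
by rewrite {1}xe expr2 -mulrA -expRD addNr expR0 mulr1.
Qed.

Lemma is_derive_logw_primitive {R : realType} n r (x : R) : 0 < x ->
  is_derive x 1 (logw_primitive n r) (x ^+ n * logw r x).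
Proof.
move=> x0; have n0 : n.+1%:R != 0 :> R by rewrite pnatr_eq0.
elim: r => [|r IHr].
  have -> : logw_primitive n 0 = (n.+1%:R)^-1 *: (@id R) ^+ n.+1 :> (R -> R).
    by apply/funext => y; rewrite /= mulrC !fctE.
  apply: is_derive_eq.
  rewrite /logw fact0 expr0 divr1 /GRing.scale/=.
  by field.
have -> : logw_primitive n r.+1 = (n.+1%:R)^-1 *:
    ((@id R) ^+ n.+1 * logw r.+1 + logw_primitive n r) :> (R -> R).
  by apply/funext => y; rewrite /= mulrC !fctE.
have dw := is_derive_logw r x x0.
apply: is_derive_eq.
rewrite !fctE /GRing.scale/= exprS.
by field; rewrite gt_eqF//= nat1r.
Qed.

(** Every boundary term [x ^+ n.+1 * logw r.+1 x] is at most [x * logw r.+1 x], which [mul_logw_le]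
    squeezes to 0 by a multiple of [sqrt x]. *)
Lemma logw_primitive0 {R : realType} n r :
  logw_primitive n r (x : R) @[x --> 0^'+] --> (0 : R).
Proof.
have x0 : x ^+ n.+1 / n.+1%:R @[x --> 0^'+] --> (0 : R).
  apply: cvg_at_right_filter.
  rewrite [X in _ --> X](_ : _ = 0 ^+ n.+1 / n.+1%:R);
    last by rewrite expr0n mul0r.
  by apply: cvgM; [exact: exprn_continuous|exact: cvg_cst].
elim: r => [//|r IHr] /=.
rewrite [X in _ --> X](_ : _ = (0 + 0) / n.+1%:R); last by rewrite addr0 mul0r.
apply: cvgM; last exact: cvg_cst.
apply: cvgD IHr.
have h0 : 2 ^+ r.+1 * Num.sqrt x @[x --> 0^'+] --> (0 : R).
  apply: cvg_at_right_filter.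
  rewrite [X in _ --> X](_ : _ = 2 ^+ r.+1 * Num.sqrt 0);
    last by rewrite sqrtr0 mulr0.
  by apply: cvgM; [exact: cvg_cst|exact: sqrt_continuous].
apply: (squeeze_cvgr _ (cvg_cst 0) h0).
near=> x.
have x0' : 0 < x by [].
have x1 : x <= 1 by near: x; exact: nbhs_right_le.
rewrite mulr_ge0 ?logw_ge0 ?exprn_ge0// ?(ltW x0')//=.
apply: le_trans (mul_logw_le r.+1 x x0' x1).
rewrite ler_wpM2r ?logw_ge0// exprS ler_piMr ?(ltW x0')//.
by rewrite exprn_ile1// ltW.
Unshelve. all: by end_near. Qed.

Lemma logw_primitive1 {R : realType} n r :
  logw_primitive n r (1 : R) = (n.+1%:R ^+ r.+1)^-1.
Proof.
elim: r => [|r IHr] /=; first by rewrite expr1n div1r expr1.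
by rewrite logw1 mulr0 add0r IHr -invfM -exprSr.
Qed.

(** Exhaustion by compact intervals that avoid the singularity of [ln] at 0. Starting at [k.+2]
    keeps each left end strictly below 1, as the fundamental theorem of calculus requires. *)
Lemma itv01_bigcup {R : realType} :
  `]0%R, 1%R]%classic = \bigcup_k `[k.+2%:R^-1, (1 : R)]%classic :> set R.
Proof.
apply/seteqP; split => x /=.
  rewrite in_itv/= => /andP[x0 x1].
  exists (Num.truncn x^-1) => //=; rewrite in_itv/= x1 andbT.
  rewrite invf_ple ?posrE//.
  apply/ltW/(lt_trans (truncnS_gt _)); by rewrite ltr_nat.
move=> [k _] /=; rewrite !in_itv/= => /andP[kx ->]; rewrite andbT.
by apply: lt_le_trans kx; rewrite invr_gt0.
Qed.

Lemma measurable_exprM_logw {R : realType} n r (D : set R) :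
  measurable_fun D (fun x : R => x ^+ n * logw r x).
Proof.
apply: measurable_funM; first exact: exprn_measurable.
apply: measurable_funM => //; apply: measurable_funX.
by apply: measurable_funN; apply: measurable_funTS; exact: measurable_ln.
Qed.

(** The integral is improper at 0: the fundamental theorem applies on each interval of the
    exhaustion, and monotone convergence for increasing domains gives the limit. *)
Lemma integral_logw {R : realType} n r :
  (\int[@lebesgue_measure R]_(x in `]0%R, 1%R[) (x ^+ n * logw r x)%:E =
   ((n.+1%:R ^+ r.+1)^-1)%:E)%E.
Proof.
have cf (x : R) : 0 < x -> {for x, continuous (fun y : R => y ^+ n * logw r y)}.
  by move=> x0; apply: cvgM; [exact: exprn_continuous|exact: logw_continuous].
rewrite integral_itv_bndo_bndc; last first.
  by apply/measurable_EFinP; exact: measurable_exprM_logw.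
rewrite itv01_bigcup.
pose F k : set R := `[k.+2%:R^-1, (1 : R)]%classic.
have ndF : nondecreasing_seq F.
  apply/nondecreasing_seqP => k; rewrite subsetEset; apply: subset_itvr.
  by rewrite bnd_simp lef_pV2 ?posrE// ler_nat.
have F0 k x : F k x -> (0 <= (x ^+ n * logw r x)%:E)%E.
  rewrite /F/= in_itv/= => /andP[kx x1].
  rewrite lee_fin mulr_ge0 ?logw_ge0// exprn_ge0//.
  by apply: le_trans kx; rewrite invr_ge0.
have mF k : measurable (F k : set (measurableTypeR R)) by exact: measurable_itv.
have mfF k : measurable_fun (F k : set (measurableTypeR R))
    (fun x => (x ^+ n * logw r x)%:E).
  by apply/measurable_EFinP; exact: measurable_exprM_logw.
have := @ge0_nondecreasing_set_cvg_integral _ (measurableTypeR R) R F _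
  (@lebesgue_measure R) ndF mF mfF F0.
move=> /(cvg_lim _) <- //.
apply: cvg_lim => //.
have E k : (\int[@lebesgue_measure R]_(x in F k) (x ^+ n * logw r x)%:E
   = (logw_primitive n r 1 - logw_primitive n r (k.+2%:R^-1)%R)%:E)%E.
  have k0 : 0 < k.+2%:R^-1 :> R by rewrite invr_gt0.
  have dF (x : R) : k.+2%:R^-1 <= x ->
      is_derive x 1 (logw_primitive n r) (x ^+ n * logw r x).
    by move=> kx; apply: is_derive_logw_primitive; exact: lt_le_trans kx.
  have cF (x : R) : k.+2%:R^-1 <= x -> {for x, continuous (logw_primitive n r)}.
    move=> /dF [dx _]; apply/differentiable_continuous.
    by rewrite -derivable1_diffP.
  have k1 : k.+2%:R^-1 < 1 :> R by rewrite invf_lt1// ltr1n.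
  rewrite (@continuous_FTC2 _ _ (logw_primitive n r))//.
  - apply: continuous_in_subspaceT => x; rewrite inE/= in_itv/= => /andP[kx _].
    by apply: cf; exact: lt_le_trans kx.
  - split.
    + by move=> x; rewrite in_itv/= => /andP[/ltW/dF[]].
    + by apply: cvg_at_right_filter; exact: cF.
    + by apply: cvg_at_left_filter; apply: cF; exact: ltW.
  - move=> x; rewrite in_itv/= => /andP[/ltW/dF dx _].
    by rewrite derive1E; exact: derive_val.
under eq_fun do rewrite E.
apply: cvg_EFin; first exact: nearW.
rewrite [X in _ --> X](_ : _ = logw_primitive n r 1 - 0); last first.
  by rewrite subr0 logw_primitive1.
apply: cvgB; first exact: cvg_cst.
(* The right limit at 0 is used along the sequence [1 / (k + 2)], a shift of the harmonic
   sequence. *)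
apply: (iffLR (cvg_at_rightP _ _ _) (logw_primitive0 n r)); split.
  by move=> k; rewrite invr_gt0.
by have := @cvg_harmonic R; rewrite -cvg_shiftS.
Qed.

(** * The signed coefficients [altB] and their generating function *)

Lemma odd_natrE {R : realType} n : 2 * n.+1%:R - 1 = n.*2.+1%:R :> R.
Proof. by rewrite -mul2n -!natr1 natrM; ring. Qed.

Definition altB {R : realType} (p n : nat) : R := (-1) ^+ n * calB_fin p n.

Lemma altB0 {R : realType} p : altB p 0 = 0 :> R.
Proof. by rewrite /altB /calB_fin big_geq// mulr0. Qed.

Lemma altBS {R : realType} p n :
  altB p n.+1 = (n.*2.+1%:R ^+ p)^-1 - altB p n :> R.
Proof.
rewrite /altB /calB_fin big_nat_recr//= mulrDr addrC; congr (_ + _).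
  (* The new term of [calB_fin] carries the same sign as the outer factor, so the two signs
     cancel. *)
  rewrite mulrA -exprD addnn -mul2n exprM sqrrN !expr1n mul1r.
  by rewrite odd_natrE.
by rewrite exprS mulN1r mulNr.
Qed.

Lemma altB_le1 {R : realType} p n : `|altB p n : R| <= 1.
Proof.
pose a k : R := (k.*2.+1%:R ^+ p)^-1.
have a_ge0 k : 0 <= a k by rewrite invr_ge0 exprn_ge0.
have a_le k : a k.+1 <= a k.
  rewrite lef_pV2 ?posrE ?exprn_gt0// lerXn2r ?nnegrE// ler_nat.
  by rewrite doubleS !ltnS ltnW.
have a_le1 k : a k <= 1 by rewrite invf_le1 ?exprn_gt0// exprn_ege1// ler1n.
(* Grouping the terms in pairs keeps the even partial sums in [a - 1, 0]. *)
have H m : a m.*2 - 1 <= (altB p m.*2 : R) <= 0.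
  elim: m => [|m /andP[IH1 IH2]].
    by rewrite double0 altB0; have := a_le1 0%N; lra.
  rewrite doubleS !altBS -/(a _) -/(a _).
  have := a_le m.*2; have := a_le m.*2.+1; lra.
(* For odd [n = 2m + 1] the recurrence gives [a (2m) - altB p (2m)], which lies in [[a (2m), 1]] by
   [H]. *)
rewrite -(odd_double_half n); case: (odd n); rewrite ?add1n ?add0n.
  rewrite altBS -/(a _) ler_norml.
  have := a_ge0 n./2.*2; have := H n./2; lra.
rewrite ler_norml; have := a_ge0 n./2.*2; have := H n./2; lra.
Qed.

Lemma calB_psumE {R : realType} p q N :
  calB_psum p q N = \sum_(k < N) altB p k.+1 / k.*2.+1%:R ^+ q :> R.
Proof.
rewrite /calB_psum big_add1 /= big_mkord; apply: eq_bigr => k _.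
by rewrite -/(altB _ _) odd_natrE.
Qed.

(** Multiplying by [1 + x ^+ 2] puts [altB p k.+1 + altB p k] in front of [x ^+ k.*2], and [altBS]
    evaluates this sum. At the bottom [altB p 0 = 0]; at the top one unpaired term remains. *)
Lemma altB_genfun {R : realType} p N (x : R) :
  (1 + x ^+ 2) * (\sum_(k < N) altB p k.+1 * x ^+ k.*2) =
  (\sum_(k < N) x ^+ k.*2 / k.*2.+1%:R ^+ p) + altB p N * x ^+ N.*2.
Proof.
elim: N => [|N IHN]; first by rewrite !big_ord0 altB0 mul0r mulr0 addr0.
rewrite !big_ord_recr/= mulrDr IHN altBS doubleS -(addn2 N.*2) exprD.
ring.
Qed.

(** * Partial sums of the polylogarithm *)

Definition Li_psum {R : realType} p (x : R) (N : nat) : R :=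
  \sum_(m < N) x ^+ m.+1 / m.+1%:R ^+ p.

Lemma LiE {R : realType} p (x : R) : Li p x = limn (Li_psum p x).
Proof.
rewrite /Li; congr (limn _); apply/funext => N.
by rewrite big_add1 big_mkord.
Qed.

Lemma Li_psum_series {R : realType} p (x : R) :
  Li_psum p x = series (fun m => x ^+ m.+1 / m.+1%:R ^+ p).
Proof. by apply/funext => N; rewrite /series/= big_mkord. Qed.

Lemma is_cvg_Li_psum {R : realType} p (x : R) : `|x| < 1 -> cvgn (Li_psum p x).
Proof.
move=> x1; rewrite Li_psum_series; apply: normed_cvg.
apply: (@series_le_cvg _ _ (fun m => geometric 1 `|x| m)) => [n|n|n|].
- by rewrite normr_ge0.
- by rewrite /= mul1r exprn_ge0.
- rewrite /= mul1r normrM normrX normfV normrX normr_nat.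
  rewrite ler_pdivrMr ?exprn_gt0// exprS.
  apply: (@le_trans _ _ (`|x| ^+ n)).
    by rewrite ler_piMl ?exprn_ge0// ltW.
  by rewrite ler_peMr ?exprn_ge0// exprn_ege1// ler1n.
- by apply: is_cvg_geometric_series; rewrite normr_id.
Qed.

Lemma cvg_Li_psum {R : realType} p (x : R) : `|x| < 1 ->
  Li_psum p x @ \oo --> Li p x.
Proof. by rewrite LiE => /(is_cvg_Li_psum p). Qed.

Lemma norm_Li_psum {R : realType} p (x : R) N :
  `|Li_psum p x N| <= Li_psum p `|x| N.
Proof.
apply: le_trans (ler_norm_sum _ _ _) _; apply: ler_sum => m _.
by rewrite normrM normrX normfV normrX normr_nat.
Qed.

Lemma nondecreasing_Li_psum {R : realType} p (x : R) : 0 <= x ->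
  nondecreasing_seq (Li_psum p x).
Proof.
move=> x0; apply/nondecreasing_seqP => N.
by rewrite /Li_psum big_ord_recr/= lerDl divr_ge0// exprn_ge0.
Qed.

Lemma Li_psum_le {R : realType} p (x : R) N : 0 <= x < 1 ->
  Li_psum p x N <= Li p x.
Proof.
move=> /andP[x0 x1]; rewrite LiE; apply: nondecreasing_cvgn_le.
  exact: nondecreasing_Li_psum.
by apply: is_cvg_Li_psum; rewrite ger0_norm.
Qed.

Lemma norm_Li_le {R : realType} p (x : R) : `|x| < 1 -> `|Li p x| <= Li p `|x|.
Proof.
move=> x1; have cL := cvg_Li_psum p x x1.
apply: (@ler_cvg_to _ _ _ _ (fun N => `|Li_psum p x N|) (Li_psum p `|x|)).
- exact: eventually_filter.
- exact: cvg_norm.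
- by apply: cvg_Li_psum; rewrite normr_id.
- by apply: nearW => N; exact: norm_Li_psum.
Qed.

(** Even powers cancel and odd powers double; an even number of terms makes the pairs complete. *)
Lemma Li_psum_odd {R : realType} p (x : R) N :
  Li_psum p x N.*2 - Li_psum p (- x) N.*2 =
  2 * x * \sum_(k < N) x ^+ k.*2 / k.*2.+1%:R ^+ p.
Proof.
elim: N => [|N IHN]; first by rewrite /Li_psum !big_ord0 mulr0 subr0.
rewrite doubleS /Li_psum !big_ord_recr/= -!/(Li_psum _ _ _) mulrDr -IHN.
rewrite !exprS -!mul2n !exprM sqrrN; ring.
Qed.

(** * Integrability against the weights and termwise integration *)

Lemma integrable_logw {R : realType} n r :
  (@lebesgue_measure R).-integrable `]0%R, 1%R[
    (EFin \o (fun x : R => x ^+ n * logw r x)).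
Proof.
apply/integrableP; split.
  by apply/measurable_EFinP; exact: measurable_exprM_logw.
rewrite (@eq_integral _ (measurableTypeR R) _ _ _
  (fun x : R => (x ^+ n * logw r x)%:E)); last first.
  move=> x; rewrite inE/= in_itv/= => /andP[x0 x1].
  by rewrite ger0_norm// mulr_ge0 ?logw_ge0 ?exprn_ge0 ?ltW.
by rewrite integral_logw ltry.
Qed.

(** The exponents [e] are left free to serve two cases: [id] for the partial sums of [Li p x / x],
    and [double] for those of the generating function of [altB]. *)
Lemma integrable_sum_logw {R : realType} (c : nat -> R) (e : nat -> nat) r N :
  (@lebesgue_measure R).-integrable `]0%R, 1%R[
    (EFin \o (fun x : R => (\sum_(k < N) c k * x ^+ e k) * logw r x)).
Proof.
elim: N => [|N IHN].
  rewrite (_ : _ \o _ = cst 0%E); first exact: integrable0.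
  by apply/funext => x/=; rewrite big_ord0 mul0r.
rewrite (_ : _ \o _ = (
  (EFin \o (fun x : R => (\sum_(k < N) c k * x ^+ e k) * logw r x)%R)
  \+ (fun x => (c N)%:E * (EFin \o (fun x : R => x ^+ e N * logw r x)%R) x))%E).
  by apply: integrableD => //;
    apply: integrableZl => //; exact: integrable_logw.
by apply/funext => x/=; rewrite big_ord_recr/= mulrDl EFinD -mulrA EFinM.
Qed.

Lemma Rintegral_sum_logw {R : realType} (c : nat -> R) (e : nat -> nat) r N :
  \int[@lebesgue_measure R]_(x in `]0, 1[)
    ((\sum_(k < N) c k * x ^+ e k) * logw r x) =
  \sum_(k < N) c k / (e k).+1%:R ^+ r.+1.
Proof.
elim: N => [|N IHN].
  rewrite big_ord0; under eq_Rintegral do rewrite big_ord0 mul0r.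
  by rewrite Rintegral_cst// mul0r.
under eq_Rintegral do rewrite big_ord_recr/= mulrDl -mulrA.
rewrite RintegralD//; last 2 first.
- exact: integrable_sum_logw.
- by apply: (@integrableZl _ (measurableTypeR R) _ _ _ _ (c N)
    (EFin \o (fun x : R => x ^+ e N * logw r x))) => //; exact: integrable_logw.
rewrite IHN big_ord_recr/= RintegralZl//; last exact: integrable_logw.
by rewrite /Rintegral integral_logw.
Qed.

Lemma sum_inv_sqr_le2 {R : realType} N :
  \sum_(m < N) (m.+1%:R ^+ 2)^-1 <= 2 :> R.
Proof.
case: N => [|N]; first by rewrite big_ord0.
(* The sharper bound [2 - 1 / N] is inductive, since [1 / (t + 1) ^ 2 <= 1 / t - 1 / (t + 1)]. *)
apply: (@le_trans _ _ (2 - N.+1%:R^-1)); last by rewrite lerBlDr lerDl.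
elim: N => [|N IHN].
  by rewrite big_ord_recr big_ord0/= add0r expr1n invr1; lra.
rewrite big_ord_recr/=; apply: le_trans (lerD IHN (lexx _)) _.
rewrite -addrA lerD2l -lerBrDl opprK addrC.
have N0 : 0 < N.+1%:R :> R by [].
have -> : N.+2%:R = N.+1%:R + 1 :> R by rewrite -natr1.
move: N0; set t := N.+1%:R => t0.
have t1 : 0 < t + 1 by lra.
rewrite -subr_ge0.
have -> : t^-1 - (t + 1)^-1 - ((t + 1) ^+ 2)^-1 = (t * (t + 1) ^+ 2)^-1.
  by field; rewrite !gt_eqF.
by rewrite invr_ge0 mulr_ge0 ?exprn_ge0 ?ltW.
Qed.

Lemma Li_psum_divx {R : realType} p (x : R) N : x != 0 ->
  \sum_(m < N) (m.+1%:R ^+ p)^-1 * x ^+ m = Li_psum p x N / x.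
Proof.
move=> x0; rewrite /Li_psum mulr_suml; apply: eq_bigr => m _.
rewrite exprS; field; rewrite x0 expf_neq0//.
Qed.

(** This function dominates all later integrands. Its partial sums [u N] are nonnegative and
    increasing, and their integrals are sums of [1 / (m + 1) ^ (p + r + 1)], bounded by 2 because
    [p + r + 1 >= 2]; monotone convergence concludes. *)
Lemma integrable_Li_logw {R : realType} p r : (0 < p)%N ->
  (@lebesgue_measure R).-integrable `]0%R, 1%R[
    (EFin \o (fun x : R => Li p x / x * logw r x)).
Proof.
move=> p0.
pose u N (x : R) := (\sum_(m < N) (m.+1%:R ^+ p)^-1 * x ^+ m) * logw r x.
have iu N : (@lebesgue_measure R).-integrable `]0%R, 1%R[ (EFin \o u N).
  exact: (integrable_sum_logw (fun m => (m.+1%:R ^+ p)^-1) id).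
have mu_ N :
    measurable_fun (`]0%R, 1%R[%classic : set (measurableTypeR R)) (u N).
  by apply/measurable_EFinP; exact: measurable_int (iu N).
have cu (x : R) : `]0%R, 1%R[%classic x ->
    u ^~ x @ \oo --> Li p x / x * logw r x.
  rewrite /= in_itv/= => /andP[x0 x1].
  rewrite /u; under eq_fun do rewrite Li_psum_divx ?gt_eqF//.
  apply: cvgM; last exact: cvg_cst.
  apply: cvgM; last exact: cvg_cst.
  by apply: cvg_Li_psum; rewrite gtr0_norm.
have u0 N (x : R) : `]0%R, 1%R[%classic x -> (0 <= (u N x)%:E)%E.
  rewrite /= in_itv/= => /andP[x0 x1].
  rewrite lee_fin mulr_ge0 ?logw_ge0 ?(ltW x1)// sumr_ge0// => m _.
  by rewrite mulr_ge0 ?invr_ge0 ?exprn_ge0 ?ltW.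
have ndu (x : R) : `]0%R, 1%R[%classic x ->
    nondecreasing_seq (fun N => (u N x)%:E).
  rewrite /= in_itv/= => /andP[x0 x1]; apply/nondecreasing_seqP => N.
  rewrite lee_fin ler_wpM2r ?logw_ge0 ?(ltW x1)// big_ord_recr/= lerDl.
  by rewrite mulr_ge0 ?invr_ge0 ?exprn_ge0 ?ltW.
apply/integrableP; split.
  by apply/measurable_EFinP; exact: measurable_fun_cvg mu_ cu.
rewrite (@eq_integral _ (measurableTypeR R) _ _ _
  (fun x : R => limn (fun N => (u N x)%:E))); last first.
  move=> x; rewrite inE => x01; apply/esym/cvg_lim => //.
  apply: cvg_EFin; first exact: nearW.
  move: (x01); rewrite /= in_itv/= => /andP[x0 x1].
  rewrite ger0_norm; first exact: cu.
  rewrite mulr_ge0 ?logw_ge0 ?divr_ge0 ?(ltW x0) ?(ltW x1)//.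
  (* [Li p x] is nonnegative because it is at least the empty partial sum. *)
  by apply: le_trans (Li_psum_le p x 0 _); rewrite ?/Li_psum ?big_ord0// ltW.
rewrite monotone_convergence//; last first.
  by move=> N; apply/measurable_EFinP; exact: mu_.
apply: (@le_lt_trans _ _ 2%:E); last exact: ltry.
apply: lime_le.
  apply: ereal_nondecreasing_is_cvgn => m n mn.
  apply: ge0_le_integral => //.
  - by move=> x; exact: u0.
  - by apply/measurable_EFinP; exact: mu_.
  - by apply/measurable_EFinP; exact: mu_.
  - by move=> x /ndu; exact.
apply: nearW => N.
have -> : (\int[@lebesgue_measure R]_(x in `]0%R, 1%R[) (u N x)%:E =
    (\sum_(m < N) (m.+1%:R ^+ p)^-1 / m.+1%:R ^+ r.+1)%R%:E)%E.
  rewrite -[LHS]fineK; last exact: integrable_fin_num (iu N).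
  by congr EFin; exact: (Rintegral_sum_logw (fun m => (m.+1%:R ^+ p)^-1) id).
rewrite lee_fin.
apply: le_trans (sum_inv_sqr_le2 N); apply: ler_sum => m _.
rewrite -invfM -exprD lef_pV2 ?posrE ?exprn_gt0//.
by rewrite ler_weXn2l ?ler1n// addnS ltnS addn_gt0 p0.
Qed.

(** A pointwise limit of polynomials is measurable; the sign [s] treats [x] and [- x] at once. *)
Lemma measurable_Li {R : realType} p (s : R) : `|s| = 1 ->
  measurable_fun (`]0%R, 1%R[%classic : set (measurableTypeR R))
    (fun x : R => Li p (s * x)).
Proof.
move=> s1.
apply: (@measurable_fun_cvg _ _ _ _ (fun N x => Li_psum p (s * x) N)) => [N|x].
  apply: measurable_sum => m; apply: measurable_funM => //.
  apply: measurable_funX; apply: measurable_funM => //.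
rewrite /= in_itv/= => /andP[x0 x1].
by apply: cvg_Li_psum; rewrite normrM s1 mul1r gtr0_norm.
Qed.

Lemma lnX_logw {R : realType} r (x : R) :
  ln x ^+ r = (-1) ^+ r * r`!%:R * logw r x.
Proof.
have r0 : r`!%:R != 0 :> R by rewrite pnatr_eq0 -lt0n fact_gt0.
rewrite -{1}[ln x]opprK (exprNn (- ln x)) /logw -mulrA.
by rewrite [r`!%:R * _]mulrC divfK.
Qed.

Lemma integrable_lnX_Li {R : realType} p r (s : R) : (0 < p)%N -> `|s| = 1 ->
  (@lebesgue_measure R).-integrable `]0%R, 1%R[
    (EFin \o (fun x : R => ln x ^+ r * Li p (s * x) / (x * (1 + x ^+ 2)))).
Proof.
move=> p0 s1.
have iL := @integrableZl _ (measurableTypeR R) _ _ _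
  (@measurable_itv R `]0, 1[) (r`!%:R)
   _ (@integrable_Li_logw R p r p0).
apply: le_integrable iL => //.
  apply/measurable_EFinP; apply: measurable_funM.
    apply: measurable_funM; last exact: measurable_Li.
    apply: measurable_funX; apply: measurable_funTS; exact: measurable_ln.
  apply: open_continuous_measurable_fun => // x.
  rewrite inE/= in_itv/= => /andP[x0 x1].
  apply: cvgV.
    by rewrite mulf_neq0 ?gt_eqF// ltr_pwDl ?exprn_ge0// ltW.
  apply: cvgM; first exact: cvg_id.
  by apply: cvgD; [exact: cvg_cst|exact: exprn_continuous].
move=> x; rewrite /= in_itv/= => /andP[x0 x1].
have x2 : 0 < 1 + x ^+ 2 by rewrite ltr_pwDl ?exprn_ge0// ltW.
have w0 : 0 <= logw r x by rewrite logw_ge0// ltW.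
have sx : `|s * x| = x by rewrite normrM s1 mul1r gtr0_norm.
have L0 : `|Li p (s * x)| <= Li p x.
  by apply: le_trans (norm_Li_le _ _ _) _; rewrite sx.
rewrite lee_fin.
apply: (@le_trans _ _ (r`!%:R * (Li p x / x * logw r x))); last first.
  exact: ler_norm.
rewrite lnX_logw; move: (logw r x) w0 => w w0.
rewrite !normrM normfV normrX normrN normr1 expr1n mul1r normr_nat.
rewrite (ger0_norm w0) normrM (gtr0_norm x0) (gtr0_norm x2) -!mulrA ler_wpM2l//.
rewrite [leRHS]mulrA [leRHS]mulrC ler_wpM2l// ler_pM//.
  by rewrite invr_ge0 mulr_ge0// ltW.
rewrite lef_pV2 ?posrE ?mulr_gt0// ler_peMr ?(ltW x0)//.
by rewrite lerDl sqr_ge0.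
Qed.

Lemma integrable_lnX_Li1 {R : realType} p r : (0 < p)%N ->
  (@lebesgue_measure R).-integrable `]0%R, 1%R[
    (EFin \o (fun x : R => ln x ^+ r * Li p x / (x * (1 + x ^+ 2)))).
Proof.
move=> p0; have := @integrable_lnX_Li R p r 1 p0 (normr1 _).
by under [X in EFin \o X]eq_fun do rewrite mul1r.
Qed.

Lemma integrable_lnX_LiN1 {R : realType} p r : (0 < p)%N ->
  (@lebesgue_measure R).-integrable `]0%R, 1%R[
    (EFin \o (fun x : R => ln x ^+ r * Li p (- x) / (x * (1 + x ^+ 2)))).
Proof.
move=> p0; have := @integrable_lnX_Li R p r (-1) p0 (normrN1 _).
by under [X in EFin \o X]eq_fun do rewrite mulN1r.
Qed.

(** * The generating function in closed form, its uniform bound, and the passage to the limit *)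

Lemma sum_altB_Li_psum {R : realType} p N (x : R) : x != 0 ->
  \sum_(k < N) altB p k.+1 * x ^+ k.*2 =
  ((Li_psum p x N.*2 - Li_psum p (- x) N.*2) / (2 * x) + altB p N * x ^+ N.*2) /
  (1 + x ^+ 2).
Proof.
move=> x0; have x2 : 1 + x ^+ 2 != 0 by rewrite gt_eqF// ltr_pwDl ?sqr_ge0.
rewrite Li_psum_odd [2 * x * _]mulrC mulfK;
  last by rewrite mulf_neq0// pnatr_eq0.
by rewrite -altB_genfun [(1 + x ^+ 2) * _]mulrC mulfK.
Qed.

Lemma cvg_sum_altB {R : realType} p (x : R) : 0 < x < 1 ->
  (fun N => \sum_(k < N) altB p k.+1 * x ^+ k.*2) @ \oo -->
  (Li p x - Li p (- x)) / (2 * x) / (1 + x ^+ 2).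
Proof.
move=> /andP[x0 x1].
under eq_fun do rewrite sum_altB_Li_psum ?gt_eqF//.
apply: cvgM; last exact: cvg_cst.
rewrite -[X in _ --> X]addr0.
have dbl : (fun N => N.*2) @ \oo --> \oo.
  by under eq_fun do rewrite -mul2n; exact: cvg_mulnl.
apply: cvgD.
  apply: cvgM; last exact: cvg_cst.
  apply: cvgB.
    apply: (cvg_comp _ _ dbl); apply: cvg_Li_psum; by rewrite gtr0_norm.
  by apply: (cvg_comp _ _ dbl); apply: cvg_Li_psum; rewrite normrN gtr0_norm.
(* The remainder [altB p N * x ^+ N.*2] vanishes in the limit, as its coefficient is bounded by
   1. *)
have xN : (fun N => x ^+ N.*2) @ \oo --> (0 : R).
  by apply: (cvg_comp _ _ dbl); apply: cvg_expr; rewrite gtr0_norm.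
have xN' : (fun N => - x ^+ N.*2) @ \oo --> (0 : R).
  by rewrite -oppr0; exact: cvgN.
apply: (squeeze_cvgr _ xN' xN); apply: nearW => N.
have xN0 : 0 <= x ^+ N.*2 by rewrite exprn_ge0 ?ltW.
by rewrite -ler_norml normrM (ger0_norm xN0) ler_piMl ?altB_le1.
Qed.

(** A bound free of [N]: in the closed form the polylogarithm part and the remainder each contribute
    at most [Li p x / x]. *)
Lemma norm_sum_altB_le {R : realType} p N (x : R) : 0 < x < 1 ->
  `|\sum_(k < N) altB p k.+1 * x ^+ k.*2| <= 2 * (Li p x / x).
Proof.
move=> /andP[x0 x1].
have x2 : 1 <= 1 + x ^+ 2 by rewrite lerDl sqr_ge0.
have Lx M : Li_psum p x M <= Li p x by rewrite Li_psum_le// x1 ltW.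
have LNx M : `|Li_psum p (- x) M| <= Li p x.
  by apply: le_trans (norm_Li_psum _ _ _) _; rewrite normrN gtr0_norm.
have L0 : 0 <= Li p x by apply: le_trans (normr_ge0 _) (LNx 0%N).
(* The first term of the series of [Li p x] is [x]; this lets [Li p x / x] absorb the remainder,
   which is at most 1. *)
have L1 : 1 <= Li p x / x.
  rewrite ler_pdivlMr// mul1r; apply: le_trans (Lx 1%N).
  by rewrite /Li_psum big_ord1 expr1 expr1n divr1.
rewrite sum_altB_Li_psum ?gt_eqF// normrM normfV.
rewrite (ger0_norm (le_trans ler01 x2)).
rewrite ler_pdivrMr ?(lt_le_trans ltr01 x2)//.
apply: (@le_trans _ _ (2 * (Li p x / x))); last first.
  by rewrite ler_peMr// mulr_ge0// divr_ge0// ltW.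
apply: le_trans (ler_normD _ _) _; rewrite [leRHS]mulr_natl mulr2n; apply: lerD.
  rewrite normrM normfV (gtr0_norm (mulr_gt0 (ltr0Sn _ 1) x0)) invfM mulrA.
  rewrite ler_wpM2r ?invr_ge0 ?(ltW x0)// ler_pdivrMr// [leRHS]mulr_natr mulr2n.
  apply: le_trans (ler_normB _ _) _; rewrite lerD//.
  by apply: le_trans (norm_Li_psum _ _ _) _; rewrite gtr0_norm.
apply: le_trans L1; rewrite normrM normrX (gtr0_norm x0) mulr_ile1 ?altB_le1//.
  by rewrite exprn_ge0 ?ltW.
by rewrite exprn_ile1 ?ltW.
Qed.

Lemma cvg_calB_psum {R : realType} p r : (0 < p)%N ->
  calB_psum p r.+1 @ \oo -->
  \int[@lebesgue_measure R]_(x in `]0, 1[)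
    ((Li p x - Li p (- x)) / (2 * x) / (1 + x ^+ 2) * logw r x).
Proof.
move=> p0.
pose S N (x : R) := (\sum_(k < N) altB p k.+1 * x ^+ k.*2) * logw r x.
pose T (x : R) := (Li p x - Li p (- x)) / (2 * x) / (1 + x ^+ 2) * logw r x.
have iS N : (@lebesgue_measure R).-integrable `]0%R, 1%R[ (EFin \o S N).
  exact: (integrable_sum_logw (fun k => altB p k.+1) double).
have mS N :
    measurable_fun (`]0%R, 1%R[%classic : set (measurableTypeR R)) (S N).
  by apply/measurable_EFinP; exact: measurable_int (iS N).
have cS (x : R) : `]0%R, 1%R[%classic x -> S ^~ x @ \oo --> T x.
  move=> /=; rewrite in_itv/= => x01.
  by apply: cvgM; [exact: cvg_sum_altB|exact: cvg_cst].
have mT : measurable_fun (`]0%R, 1%R[%classic : set (measurableTypeR R)) T.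
  exact: measurable_fun_cvg mS cS.
(* The constant 2 is that of [norm_sum_altB_le], whose bound times [logw r x] is the dominating
   function. *)
have iG := @integrableZl _ (measurableTypeR R) _ _ _
  (@measurable_itv R `]0, 1[) 2
   _ (@integrable_Li_logw R p r p0).
have [||||iT _ cvgS] := @dominated_convergence _ (measurableTypeR R) R
  (@lebesgue_measure R) `]0%R, 1%R[%classic (@measurable_itv R `]0, 1[)
  (fun N => EFin \o S N) (EFin \o T) _ _ _ _ iG.
- by move=> N; apply/measurable_EFinP; exact: mS.
- exact/measurable_EFinP.
- apply: aeW => x x01; apply: cvg_EFin; first exact: nearW.
  exact: cS.
- apply: aeW => x N; rewrite /= in_itv/= => x01.
  have /andP[x0 x1] := x01.
  rewrite lee_fin normrM mulrA (ger0_norm (logw_ge0 _ _ (ltW x1))).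
  by rewrite ler_wpM2r ?logw_ge0 ?(ltW x1)// norm_sum_altB_le.
have -> : calB_psum p r.+1 =
    (fun N => \int[@lebesgue_measure R]_(x in `]0, 1[) S N x).
  apply/funext => N; rewrite calB_psumE.
  by rewrite (Rintegral_sum_logw (fun k => altB p k.+1) double).
(* Dominated convergence holds in the extended reals; finiteness of the limit integral brings it
   back to the reals. *)
apply: fine_cvg; rewrite /Rintegral fineK//.
exact: integrable_fin_num iT.
Qed.

Theorem theorem5p7 (R : realType) (p q : nat) (hp : (0 < p)%N) (hq : (0 < q)%N) :
  let mu := @lebesgue_measure R in
  let f := fun x : R => ln x ^+ q.-1 * Li p (- x) / (x * (1 + x ^+ 2)) in
  let g := fun x : R => ln x ^+ q.-1 * Li p x / (x * (1 + x ^+ 2)) in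
  [/\ cvgn (@calB_psum R p q),
      mu.-integrable `]0, 1[ (EFin \o f),
      mu.-integrable `]0, 1[ (EFin \o g) &
      calB p q = (-1) ^+ q / (2 * (q.-1)`!%:R) *
        (\int[mu]_(x in `]0, 1[) f x - \int[mu]_(x in `]0, 1[) g x)].
Proof.
case: q hq => // r _ mu f g; rewrite -[r.+1.-1]/r in f g *.
have iF : mu.-integrable `]0, 1[ (EFin \o f) by exact: integrable_lnX_LiN1.
have iG : mu.-integrable `]0, 1[ (EFin \o g) by exact: integrable_lnX_Li1.
have cB := @cvg_calB_psum R p r hp.
split => //; first by apply/cvg_ex; eexists; exact: cB.
rewrite /calB (cvg_lim _ cB)// -RintegralB// -RintegralZl//; last first.
  exact: (@integrableB _ (measurableTypeR R) R (@lebesgue_measure R) _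
    (@measurable_itv R `]0, 1[) _ _ iF iG).
apply: eq_Rintegral => x; rewrite inE/= in_itv/= => /andP[x0 x1].
rewrite /f /g lnX_logw [(-1) ^+ r.+1]exprS.
have r0 : r`!%:R != 0 :> R by rewrite pnatr_eq0 -lt0n fact_gt0.
have x2 : 1 + x ^+ 2 != 0 by rewrite gt_eqF// ltr_pwDl ?sqr_ge0.
have s1 : (-1) ^+ r * (-1) ^+ r = 1 :> R by rewrite -exprMn mulrNN mulr1 expr1n.
move: ((-1) ^+ r) s1 => s s1.
(* With [q = r + 1], the prefactor contributes [- s] and [ln x ^+ r] contributes [s], where [s]
   stands for [(-1) ^+ r]. Since [s * s = 1], only a minus sign survives, and it turns
   [Li p (- x) - Li p x] into [Li p x - Li p (- x)]. *)
transitivity ((s * s) *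
  ((Li p x - Li p (- x)) / (2 * x) / (1 + x ^+ 2) * logw r x)).
  by rewrite s1 mul1r.
by field; rewrite r0 x2 gt_eqF.
Qed.
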